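(* Let $A$ be a real $m\times m$ matrix with nonnegative entries and let $r=r(A)$ be its spectral radius. Then $r\in\sigma(A)$, and the principal dominant eigenspace $\mathrm{DE}_r(A)$ has a basis consisting of nonnegative eigenvectors. In particular, if $r$ is semisimple, then the principal eigenspace $\mathrm{E}_r(A)$ has a basis consisting of nonnegative eigenvectors.
   Context: $\sigma(A)$ is the set of (complex) eigenvalues of $A$ and $r(A)=\max\{|\mu|:\mu\in\sigma(A)\}$. A vector is nonnegative if all its components are $\ge 0$. For a real eigenvalue $\mu$ of $A$: $\mathrm{E}_\mu(A)=\ker(A-\mu I)\subset\mathbb R^m$; $\mathrm{GE}_\mu(A)=\{\xi\in\mathbb R^m:(A-\mu I)^k\xi=0\text{ for some }k\ge1\}$; $\mu$ is semisimple if $\mathrm{GE}_\mu(A)=\mathrm{E}_\mu(A)$. For $0\ne\xi\in\mathrm{GE}_\mu(A)$, $\mathrm{Ord}(\xi)$ is the smallest $k\ge1$ with $(A-\mu I)^k\xi=0$, and $\mathrm{Cord}(\mathrm{GE}_\mu(A))=\max_\xi\mathrm{Ord}(\xi)$ (cyclic order). With $\nu=\mathrm{Cord}(\mathrm{GE}_\mu(A))$, a dominant eigenvector is an eigenvector $w\in\mathrm E_\mu(A)$ of the form $w=(A-\mu I)^{\nu-1}\xi$ for some $\xi\in\mathrm{GE}_\mu(A)$, and the dominant eigenspace $\mathrm{DE}_\mu(A)$ is the span of the dominant eigenvectors. *)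

(* Defs.v *)
From HB Require Import structures.
From mathcomp Require Import all_boot all_order all_algebra.
From mathcomp Require Import complex.
From mathcomp Require Import boolp classical_sets reals.

Set Implicit Arguments.
Unset Strict Implicit.
Unset Printing Implicit Defensive.

Import Order.TTheory GRing.Theory Num.Theory.

Local Open Scope classical_set_scope.
Local Open Scope ring_scope.
Local Open Scope complex_scope.

(* Matrices act on column vectors, whereas [eigenvalue] of mxalgebra is about
   row vectors; hence the detour through the linear map [mulmx _]. *)
Definition spectrum (R : realType) (m : nat) (A : 'M[R]_m) : set R[i] :=
  [set z | passmx.leigenvalue
             (linfun (mulmx (map_mx (real_complex R) A) : 'cV_m -> 'cV_m)) z].

(* For 0 < m the spectrum is finite and nonempty, so this sup is a maximum.
   The norm of R[i] takes its (real) values in R[i], hence [complex.Re]. *)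
Definition spectral_radius (R : realType) (m : nat) (A : 'M[R]_m) : R :=
  sup [set complex.Re `|z| | z in spectrum A].

Definition eigspace (R : realType) (m : nat) (A : 'M[R]_m) (mu : R) :
    set 'cV[R]_m :=
  [set x | (A - mu%:M) *m x = 0].

Definition gen_eigspace (R : realType) (m : nat) (A : 'M[R]_m) (mu : R) :
    set 'cV[R]_m :=
  [set x | exists2 k, (1 <= k)%N & (A - mu%:M) ^+ k *m x = 0].

Definition semisimple (R : realType) (m : nat) (A : 'M[R]_m) (mu : R) : Prop :=
  gen_eigspace A mu = eigspace A mu.

(* The infimum of a nonempty set of naturals is its least element; the value
   is the default 0 when x is not a generalized eigenvector. *)
Definition eig_order (R : realType) (m : nat) (A : 'M[R]_m) (mu : R)
    (x : 'cV[R]_m) : nat :=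
  infimum 0%N [set k | (1 <= k)%N /\ (A - mu%:M) ^+ k *m x = 0].

(* Orders are at most m, so for an eigenvalue mu this supremum is a maximum. *)
Definition cyclic_order (R : realType) (m : nat) (A : 'M[R]_m) (mu : R) : nat :=
  supremum 0%N
    [set eig_order A mu x | x in [set x | gen_eigspace A mu x /\ x != 0]].

Definition dominant_eigenvector (R : realType) (m : nat) (A : 'M[R]_m)
    (mu : R) (w : 'cV[R]_m) : Prop :=
  [/\ w != 0, eigspace A mu w
    & exists2 x, gen_eigspace A mu x
               & w = (A - mu%:M) ^+ (cyclic_order A mu).-1 *m x].

Definition set_span (R : realType) (m : nat) (S : set 'cV[R]_m) :
    set 'cV[R]_m :=
  [set x | exists s : seq 'cV[R]_m,
      (forall v, v \in s -> S v) /\ x \in <<s>>%VS].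

Definition dominant_eigspace (R : realType) (m : nat) (A : 'M[R]_m) (mu : R) :
    set 'cV[R]_m :=
  set_span [set w | dominant_eigenvector A mu w].

Definition is_basis (R : realType) (m : nat) (b : seq 'cV[R]_m)
    (W : set 'cV[R]_m) : Prop :=
  free b /\ [set x | x \in <<b>>%VS] = W.

Definition has_nonneg_eigenbasis (R : realType) (m : nat) (A : 'M[R]_m)
    (mu : R) (W : set 'cV[R]_m) : Prop :=
  exists b : seq 'cV[R]_m, is_basis b W /\
    forall v, v \in b ->
      [/\ v != 0, eigspace A mu v & v \is a mxOver Num.nneg].

(* Main.v *)
(** Write [p] for the minimal polynomial of [A].  For each [z],
    [g_z(A) = (p(z) - p(A)) / (z - A)] satisfies [(z - A) g_z(A) = p(z)] and has
    entries polynomial in [z].  Let [s] be the infimum of the reals [w] for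
    which some [x > 0] has [A x < w x].  Above [s] the resolvent is nonnegative
    and [p] is positive, so [g_z(A) >= 0], and by continuity [g_s(A) >= 0].
    If [p(s)] were nonzero, [x = g_s(A) 1 / p(s)] would give [A x < s x], and
    this condition is open in [s]: hence [s] is an eigenvalue.  Since
    [|lambda| |x| <= A |x|] for every complex eigenpair, [s] is the spectral
    radius.  Finally [p = (X - s)^nu q] with [q(s) <> 0], so that
    [g_s(A) = (A - s)^(nu-1) q(A)], and by Bezout [q(A)] is invertible on the
    generalized eigenspace: the dominant eigenspace is the column space of the
    nonnegative matrix [g_s(A)], and it suffices to extract a basis from its
    columns. *)

Require Import Defs.
From mathcomp Require Import all_boot all_order all_algebra.
From mathcomp Require Import complex polyrcf.
From mathcomp Require Import boolp classical_sets reals.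

Set Implicit Arguments.
Unset Strict Implicit.
Unset Printing Implicit Defensive.

Import Order.TTheory GRing.Theory Num.Theory.

Local Open Scope ring_scope.
Local Open Scope complex_scope.

(** * Linear algebra over a field: free subfamilies and the minimal polynomial *)

Lemma free_subseq_span (F : fieldType) (vT : vectType F) (s : seq vT) :
  exists b, [/\ free b, {subset b <= s} & (<<b>> = <<s>>)%VS].
Proof.
elim: s => [|v s [b [b_free b_sub b_span]]].
  by exists [::]; rewrite /free span_nil dimv0.
have [vb|vNb] := boolP (v \in <<b>>%VS).
  exists b; split=> // [u /b_sub us|]; first by rewrite inE us orbT.
  by rewrite span_cons -b_span; apply/esym/addv_idPr; rewrite -memvE.
exists (v :: b); split; first by rewrite free_cons vNb.
  by move=> u; rewrite !inE => /orP[->//|/b_sub ->]; rewrite orbT.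
by rewrite !span_cons b_span.
Qed.

Section MinimalPolynomial.

Variables (F : fieldType) (n : nat) (A : 'M[F]_n.+1) (mu : F).

Let N : 'M[F]_n.+1 := A - mu%:M.

Lemma horner_mxM p q : horner_mx A (p * q) = horner_mx A p *m horner_mx A q.
Proof. exact: rmorphM. Qed.

Lemma horner_mx_XsubC : horner_mx A ('X - mu%:P) = N.
Proof. by rewrite rmorphB /= horner_mx_X horner_mx_C. Qed.

Lemma horner_mx_XsubC_exp k : horner_mx A (('X - mu%:P) ^+ k) = N ^+ k.
Proof. by rewrite rmorphXn /= horner_mx_XsubC. Qed.

(** A Bezout relation [u * p + v * q = 1] makes [horner_mx A v] a left inverse of [horner_mx A q] on
    the kernel of [horner_mx A p]. *)
Lemma horner_mx_coprime_ker (p q : {poly F}) (x : 'cV[F]_n.+1) :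
  coprimep p q -> horner_mx A p *m x = 0 ->
  exists v, x = horner_mx A v *m (horner_mx A q *m x).
Proof.
move=> /Bezout_eq1_coprimepP[[u v] /= uv1] px0; exists v.
rewrite mulmxA -horner_mxM.
have -> : v * q = 1 - u * p by rewrite -uv1 addrAC subrr add0r.
rewrite rmorphB rmorph1 /= horner_mxM mulmxBl mul1mx -mulmxA.
by rewrite px0 mulmx0 subr0.
Qed.

(** The degree of [q] is one less than that of the minimal polynomial, so [q] cannot annihilate
    [A]. *)
Lemma mxminpoly_cofactor_neq0 (q : {poly F}) :
  mxminpoly A = q * ('X - mu%:P) -> horner_mx A q != 0.
Proof.
move=> pE; have q_neq0 : q != 0.
  apply/eqP => q0; have := monic_neq0 (mxminpoly_monic A).
  by rewrite pE q0 mul0r eqxx.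
rewrite -dvd_mxminpoly; apply/negP => /(dvdp_leq q_neq0).
by rewrite pE size_Mmonic ?monicXsubC // size_XsubC addn2 ltnn.
Qed.

Lemma mxminpoly_root_eigvec :
  root (mxminpoly A) mu -> exists2 x : 'cV[F]_n.+1, x != 0 & A *m x = mu *: x.
Proof.
move=> /factor_theorem[q pE].
have /matrix0Pn[i [j Dij]] := mxminpoly_cofactor_neq0 pE.
(* Since [N *m horner_mx A q] vanishes, every nonzero column of [horner_mx A q] is an
   eigenvector. *)
exists (col j (horner_mx A q)).
  by apply/matrix0Pn; exists i, 0; rewrite mxE.
apply/eqP; rewrite -mul_scalar_mx -subr_eq0 -mulmxBl colE mulmxA.
rewrite -/N -horner_mx_XsubC -horner_mxM.
by rewrite mulrC -pE mx_root_minpoly mul0mx.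
Qed.

Variables (nu : nat) (q : {poly F}).
Hypothesis pE : mxminpoly A = q * ('X - mu%:P) ^+ nu.+1.
Hypothesis q_mu : ~~ root q mu.

Let D : 'M[F]_n.+1 := horner_mx A (q * ('X - mu%:P) ^+ nu).

Let q_coprime k : coprimep q (('X - mu%:P) ^+ k).
Proof. by apply: coprimep_expr; rewrite coprimep_XsubC. Qed.

(** By [pE], the vector [N ^+ nu.+1 *m x] is killed by [horner_mx A q]; it is also killed by
    [N ^+ k]. The two polynomials are coprime, so it is zero. *)
Lemma gen_ker_stable k (x : 'cV[F]_n.+1) :
  N ^+ k *m x = 0 -> N ^+ nu.+1 *m x = 0.
Proof.
move=> Nkx0.
have [|v ->] := @horner_mx_coprime_ker q _ (N ^+ nu.+1 *m x) (q_coprime k).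
  rewrite mulmxA -horner_mx_XsubC_exp -horner_mxM.
  by rewrite -pE mx_root_minpoly mul0mx.
rewrite horner_mx_XsubC_exp [N ^+ k *m _]mulmxA -[N ^+ k *m _]/(_ * _) -exprD.
by rewrite addnC exprD -mulmxA Nkx0 !mulmx0.
Qed.

Lemma dominant_mx_neq0 : D != 0.
Proof. by apply: mxminpoly_cofactor_neq0; rewrite -mulrA -exprSr. Qed.

Lemma dominant_mxE : D = N ^+ nu *m horner_mx A q.
Proof. by rewrite /D mulrC horner_mxM horner_mx_XsubC_exp. Qed.

Lemma dominant_mx_ker (y : 'cV[F]_n.+1) : N *m (D *m y) = 0.
Proof.
rewrite mulmxA dominant_mxE mulmxA -[N *m _]/(_ * _) -exprS.
rewrite -horner_mx_XsubC_exp -horner_mxM mulrC.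
by rewrite -pE mx_root_minpoly mul0mx.
Qed.

(** On vectors killed by a power of [N], some polynomial in [A] inverts [horner_mx A q]; applying it
    to [x] gives [y]. *)
Lemma dominant_mx_image k (x : 'cV[F]_n.+1) :
  N ^+ k *m x = 0 -> exists y, N ^+ nu *m x = D *m y.
Proof.
rewrite -horner_mx_XsubC_exp => Nkx0.
have [|v {1}->] := @horner_mx_coprime_ker _ q x _ Nkx0.
  by rewrite coprimep_sym.
exists (horner_mx A v *m x).
rewrite dominant_mxE -!mulmxA; congr (_ *m _).
by rewrite !mulmxA; congr (_ *m _); apply: comm_horner_mx2.
Qed.

End MinimalPolynomial.

(** * Computing orders and the cyclic order *)

(** For nonempty [S], [infimum] chooses an element of [infimums S], a set with at most one element,
    so the choice is forced. *)
Lemma infimum_least disp (T : porderType disp) (x0 : T) (S : set T) (k : T) :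
  S k -> lbound S k -> infimum x0 S = k.
Proof.
move=> Sk lbk; rewrite /infimum ifF; last first.
  by apply/negbTE/set0P; exists k.
have infk : infimums S k by split=> // y; apply.
by case: xgetP => [y _|/(_ k)//]; move/is_subset1_infimums; apply.
Qed.

Lemma supremum_greatest disp (T : porderType disp) (x0 : T) (S : set T)
    (k : T) :
  S k -> ubound S k -> supremum x0 S = k.
Proof.
move=> Sk ubk; rewrite /supremum ifF; last first.
  by apply/negbTE/set0P; exists k.
have supk : supremums S k by split=> // y; apply.
by case: xgetP => [y _|/(_ k)//]; move/is_subset1_supremums; apply.
Qed.

Lemma mulmx_exp_eq0 (R : pzRingType) (m : nat) (N : 'M[R]_m)
    (x : 'cV[R]_m) j k :
  (j <= k)%N -> N ^+ j *m x = 0 -> N ^+ k *m x = 0.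
Proof.
by move=> /subnK <- Nx; rewrite exprD -[_ * _]/(_ *m _) -mulmxA Nx mulmx0.
Qed.

Section CyclicOrder.

Variables (R : realType) (m : nat) (A : 'M[R]_m) (mu : R) (nu : nat).

Local Notation N := (A - mu%:M).

Lemma eig_order_eq (x : 'cV[R]_m) :
  N ^+ nu *m x != 0 -> N ^+ nu.+1 *m x = 0 -> eig_order A mu x = nu.+1.
Proof.
move=> Nnu Nnu1; apply: infimum_least => // j [_ Nj].
by rewrite leEnat ltnNge; apply: contra Nnu => /mulmx_exp_eq0/(_ Nj) ->.
Qed.

Lemma eig_order_le (x : 'cV[R]_m) :
  N ^+ nu.+1 *m x = 0 -> (eig_order A mu x <= nu.+1)%N.
Proof.
move=> Nnu1; pose P k := (1 <= k)%N && (N ^+ k *m x == 0).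
have exP : exists k, P k by exists nu.+1; rewrite /P Nnu1 eqxx.
have [k /andP[k1 /eqP Nk] k_min] := ex_minnP exP.
rewrite [eig_order _ _ _](@infimum_least _ _ _ _ k) //.
  by apply: k_min; rewrite /P Nnu1 eqxx.
by move=> j [j1 Nj]; apply: k_min; rewrite /P j1 Nj eqxx.
Qed.

Lemma cyclic_order_eq (x : 'cV[R]_m) :
  (forall y, gen_eigspace A mu y -> N ^+ nu.+1 *m y = 0) ->
  N ^+ nu *m x != 0 -> N ^+ nu.+1 *m x = 0 -> cyclic_order A mu = nu.+1.
Proof.
move=> genN Nnu Nnu1; apply: supremum_greatest.
  exists x; last exact: eig_order_eq.
  split; first by exists nu.+1.
  by apply: contra Nnu => /eqP ->; rewrite mulmx0.
by move=> _ [y [geny _] <-]; apply/eig_order_le/genN.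
Qed.

End CyclicOrder.

(** * Positive vectors with [A x < w x] and a comparison principle *)

Section PositiveSupersolutions.

Variables (R : realFieldType) (n : nat) (A : 'M[R]_n.+1).

Definition strict_supersolution (w : R) (x : 'cV[R]_n.+1) : Prop :=
  (forall i, 0 < x i 0) /\ (forall i, (A *m x) i 0 < w * x i 0).

Lemma strict_supersolution_exists : exists w x, strict_supersolution w x.
Proof.
(* For the all-ones vector, the condition only asks that every row sum of [A] be below [w]. *)
exists (1 + \sum_i `|\sum_j A i j|), (const_mx 1).
split=> i; rewrite !mxE // mulr1.
under eq_bigr do rewrite mxE mulr1.
rewrite (le_lt_trans (ler_norm _)) //.
rewrite [X in _ < _ + X](bigD1 i) //= addrCA ltrDl.
by rewrite ltr_wpDr ?sumr_ge0.
Qed.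

Lemma strict_supersolutionW w w' x :
  w <= w' -> strict_supersolution w x -> strict_supersolution w' x.
Proof.
move=> le_ww' [x0 Axw]; split=> // i.
by apply: (lt_le_trans (Axw i)); rewrite ler_pM2r.
Qed.

Lemma strict_supersolution_open w x :
  strict_supersolution w x -> exists2 e, 0 < e & strict_supersolution (w - e) x.
Proof.
move=> [x0 Axw]; pose f i := w - (A *m x) i 0 / x i 0.
(* The smallest slack, capped at 1; only half of it is taken off [w], which keeps the inequalities
   strict. *)
pose e := \big[Order.min/1]_i f i.
have e0 : 0 < e.
  by apply: lt_bigmin => // i _; rewrite subr_gt0 ltr_pdivrMr.
exists (e / 2); first by rewrite divr_gt0.
split=> // i; rewrite -ltr_pdivrMr // ltrBrDl -ltrBrDr.
apply: (@lt_le_trans _ _ e); first by rewrite ltr_pdivrMr // ltr_pMr ?ltr1n.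
exact: bigmin_le.
Qed.

Hypothesis A_ge0 : A \is a mxOver Num.nneg.

Let A0 i j : 0 <= A i j.
Proof. by move/mxOverP: A_ge0 => /(_ i j); rewrite nnegrE. Qed.

Lemma strict_supersolution_gt0 w x : strict_supersolution w x -> 0 < w.
Proof.
move=> [x0 Axw]; rewrite -(pmulr_lgt0 w (x0 0)); apply: le_lt_trans (Axw 0).
by rewrite mxE sumr_ge0 // => j _; rewrite mulr_ge0 // ltW.
Qed.

(* Otherwise look at an index where [y i / x i] is minimal, hence negative. *)
Lemma supersolution_ge0 w x (y : 'cV[R]_n.+1) :
  strict_supersolution w x -> (forall i, (A *m y) i 0 <= w * y i 0) ->
  forall i, 0 <= y i 0.
Proof.
move=> [x0 Axw] Ayw i.
have [k _ k_min] := @arg_minP _ _ _ i xpredT (fun j => y j 0 / x j 0) isT.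
rewrite leNgt; apply/negP => yi0.
set t := y k 0 / x k 0 in k_min.
have t0 : t < 0.
  by apply: (le_lt_trans (k_min i isT)); rewrite pmulr_llt0 ?invr_gt0.
have yk : y k 0 = t * x k 0 by rewrite /t divfK // gt_eqF.
have := Ayw k; rewrite leNgt => /negP; apply.
apply: (@lt_le_trans _ _ (t * (A *m x) k 0)).
  by rewrite yk mulrCA ltr_nM2l.
rewrite !mxE mulr_sumr ler_sum // => j _.
by rewrite mulrCA ler_wpM2l // -ler_pdivlMr ?k_min.
Qed.

Lemma supersolution_inj w x (y : 'cV[R]_n.+1) :
  strict_supersolution w x -> A *m y = w *: y -> y = 0.
Proof.
move=> wx Ayw; apply/colP => i; rewrite mxE; apply/le_anti/andP; split.
  rewrite -oppr_ge0; have := @supersolution_ge0 w x (- y) wx _ i.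
  by rewrite mxE; apply=> j; rewrite mulmxN Ayw !mxE mulrN.
by apply: supersolution_ge0 wx _ i => j; rewrite Ayw mxE.
Qed.

Lemma strict_supersolution_of_ge0 w (x : 'cV[R]_n.+1) :
  (forall i, 0 <= x i 0) -> w *: x - A *m x = const_mx 1 ->
  strict_supersolution w x.
Proof.
move=> x0 wx1.
have wxE i : w * x i 0 = 1 + (A *m x) i 0.
  by move/colP/(_ i): wx1 => /eqP; rewrite !mxE subr_eq => /eqP.
have Ax0 i : 0 <= (A *m x) i 0.
  by rewrite mxE sumr_ge0 // => j _; rewrite mulr_ge0.
split=> i; last by rewrite wxE ltrDr.
(* A zero coordinate [x i 0] would make [1 + (A *m x) i 0] zero, although it is positive. *)
rewrite lt0r x0 andbT; apply: contraTneq (ltr_wpDr (Ax0 i) ltr01) => xi0.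
by rewrite -wxE xi0 mulr0 ltxx.
Qed.

End PositiveSupersolutions.

(** * Signs of real polynomials, and difference quotients *)

Lemma poly_ge0_right_limit (R : rcfType) (p : {poly R}) (a : R) :
  (forall z, a < z -> 0 <= p.[z]) -> 0 <= p.[a].
Proof.
move=> p0; rewrite leNgt; apply/negP => pa0.
have /(poly_cont a p)[d d0 pd] : 0 < - p.[a] by rewrite oppr_gt0.
have := pd (a + d / 2); rewrite addrAC subrr add0r gtr0_norm ?divr_gt0 //.
rewrite ltr_pdivrMr // ltr_pMr ?ltr1n // => /(_ isT).
rewrite real_ltr_norml ?num_real // => /andP[_].
rewrite ltrBlDr addNr ltNge => /negP; apply; apply: p0.
by rewrite ltrDl divr_gt0.
Qed.

(** Without roots to the right of [a], the sign at [a] is the sign at infinity, that of the leading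
    coefficient. *)
Lemma monic_gt0 (R : rcfType) (p : {poly R}) (a : R) :
  p \is monic -> (forall z, a <= z -> ~~ root p z) -> 0 < p.[a].
Proof.
move=> p_monic p_root; rewrite -sgr_gt0 (@sgp_pinftyP _ a).
- by rewrite /sgp_pinfty (monicP p_monic) sgr1.
- by move=> z; rewrite in_itv /= andbT => /p_root.
- by rewrite in_itv /= lexx.
Qed.

(* [horner_mx A g] stands for [(p(z) - p(A)) / (z - A)], which makes sense
   whether or not [z] is an eigenvalue. *)
Lemma horner_mx_difference_quotient (F : fieldType) (n : nat) (A : 'M[F]_n.+1)
    (p : {poly F}) :
  exists Q : 'I_n.+1 -> 'I_n.+1 -> {poly F}, forall z, exists g,
    p - p.[z]%:P = g * ('X - z%:P) /\
    forall i j, horner_mx A g i j = (Q i j).[z].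
Proof.
elim/poly_ind: p => [|p c [Q IH]].
  exists (fun _ _ => 0) => z; exists 0; split=> [|i j].
    by rewrite horner0 mul0r subrr.
  by rewrite rmorph0 mxE horner0.
exists (fun i j => (horner_mx A p i j)%:P + 'X * Q i j) => z.
have [g [pg gQ]] := IH z; exists (p + z%:P * g); split=> [|i j].
  rewrite mulrDl -mulrA -pg !hornerE polyCD polyCM.
  by rewrite mulrBr mulrBr opprD addrACA subrr addr0 [p.[z]%:P * _]mulrC
             [z%:P * p]mulrC addrA subrK.
by rewrite rmorphD /= horner_mxM horner_mx_C mul_scalar_mx !mxE gQ !hornerE.
Qed.

(** * The threshold of supersolutions is a root of the minimal polynomial *)

Section Perron.

Variables (R : realType) (n : nat) (A : 'M[R]_n.+1).
Hypothesis A_ge0 : A \is a mxOver Num.nneg.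

(** Take the infimum of the admissible [w]; admissibility is an open condition, so the infimum is
    not attained. *)
Lemma supersolution_threshold :
  exists s, (forall w, s < w -> exists x, strict_supersolution A w x) /\
    ~ exists x, strict_supersolution A s x.
Proof.
pose T := [set w | exists x, strict_supersolution A w x]%classic.
have T_lb : has_lbound T.
  by exists 0 => w [x /(strict_supersolution_gt0 A_ge0)/ltW].
exists (inf T); split=> [w|[x sx]].
  have Tne : (T !=set0)%classic.
    by have [v [x vx]] := strict_supersolution_exists A; exists v, x.
  move=> /(inf_lt Tne)[v [x vx] vw]; exists x.
  exact: strict_supersolutionW (ltW vw) vx.
have [e e0 ex] := strict_supersolution_open sx.
have /(ge_inf T_lb) : T (inf T - e) by exists x.
by rewrite lerBrDr gerDl leNgt e0.
Qed.

Variable s : R.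
Hypothesis s_lim : forall w, s < w -> exists x, strict_supersolution A w x.

Lemma mxminpoly_gt0_above w : s < w -> 0 < (mxminpoly A).[w].
Proof.
move=> sw; apply: monic_gt0 (mxminpoly_monic A) _ => z wz; apply/negP.
move=> /mxminpoly_root_eigvec[y y0 Ayz].
have [x zx] := s_lim (lt_le_trans sw wz).
by move: y0; rewrite (supersolution_inj A_ge0 zx Ayz) eqxx.
Qed.

Lemma mxminpoly_quotient_ge0 g :
  mxminpoly A - (mxminpoly A).[s]%:P = g * ('X - s%:P) ->
  forall i j, 0 <= horner_mx A g i j.
Proof.
move=> gE i j; have [Q Q_quot] := horner_mx_difference_quotient A (mxminpoly A).
have [g' [g'E g'Q]] := Q_quot s.
(* Cancelling ['X - s%:P] identifies [g] with the member at [s] of a family whose entries are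
   polynomial in [z], so a limit from the right applies. *)
have -> : g = g' by apply: (mulIf (negbT (polyXsubC_eq0 s))); rewrite -gE.
rewrite g'Q; apply: poly_ge0_right_limit => z sz.
have [h [hE <-]] := Q_quot z; have [x zx] := s_lim sz.
(* Column [j] of [horner_mx A h] thus satisfies [A y = z y - p(z) e_j] with [p(z) > 0], and the
   comparison principle applies to it. *)
have hA : (A - z%:M) *m horner_mx A h = - (mxminpoly A).[z]%:M.
  by rewrite -horner_mx_XsubC -horner_mxM mulrC -hE rmorphB /=
             mx_root_minpoly horner_mx_C sub0r.
have := supersolution_ge0 A_ge0 (y := col j (horner_mx A h)) zx _ i.
rewrite mxE; apply=> k; rewrite -subr_le0.
have := congr1 (fun M : 'M_n.+1 => M k j) hA.
rewrite mulmxBl mul_scalar_mx !mxE.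
under [X in _ -> X - _ <= 0]eq_bigr do rewrite mxE.
move=> ->; rewrite oppr_le0 mulrn_wge0 // ltW //.
exact: mxminpoly_gt0_above.
Qed.

Lemma mxminpoly_root_threshold :
  ~ (exists x, strict_supersolution A s x) -> root (mxminpoly A) s.
Proof.
move=> Ns; apply/negPn/negP => ps_neq0; apply: Ns.
set c := (mxminpoly A).[s].
have c0 : 0 < c.
  rewrite lt0r ps_neq0; apply: poly_ge0_right_limit => z.
  by move=> /mxminpoly_gt0_above/ltW.
have [Q /(_ s)[g [gE _]]] := horner_mx_difference_quotient A (mxminpoly A).
have g0 := mxminpoly_quotient_ge0 gE.
(* This is the solution of [(s - A) x = 1], with the all-ones vector on the right. *)
exists (c^-1 *: (horner_mx A g *m const_mx 1)).
apply: (strict_supersolution_of_ge0 A_ge0) => [i|].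
  rewrite mxE mulr_ge0 ?invr_ge0 ?(ltW c0) // mxE sumr_ge0 // => j _.
  by rewrite mxE mulr1.
rewrite -mul_scalar_mx -mulmxBl -scalemxAr mulmxA.
have -> : (s%:M - A) *m horner_mx A g = c%:M.
  rewrite -opprB mulNmx -horner_mx_XsubC -horner_mxM mulrC -gE -rmorphN opprB.
  by rewrite rmorphB /= mx_root_minpoly horner_mx_C subr0.
by rewrite mul_scalar_mx scalerA mulVf ?scale1r // gt_eqF.
Qed.

End Perron.

(** * Complex eigenvalues and the spectral radius *)

Lemma spectrumP (R : realType) (m : nat) (A : 'M[R]_m) (z : R[i]) :
  spectrum A z <->
  exists2 x : 'cV[R[i]]_m, x != 0 & map_mx (real_complex R) A *m x = z *: x.
Proof.
rewrite /spectrum /= /passmx.leigenvalue /passmx.leigenspace.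
set f := linfun _; have fE x : (x \in lker (f - z *: \1%VF)) =
    (map_mx (real_complex R) A *m x == z *: x).
  by rewrite memv_ker add_lfunE opp_lfunE scale_lfunE id_lfunE lfunE subr_eq0.
split=> [|[x x0 /eqP Ax]].
  rewrite -vpick0 => x0; exists (vpick (lker (f - z *: \1%VF))) => //.
  by apply/eqP; rewrite -fE memv_pick.
by apply: contraNneq x0 => ker0; rewrite -memv0 -ker0 fE.
Qed.

Lemma real_spectrum (R : realType) (m : nat) (A : 'M[R]_m) (mu : R)
    (x : 'cV[R]_m) :
  x != 0 -> A *m x = mu *: x -> spectrum A mu%:C.
Proof.
move=> x0 Ax; apply/spectrumP; exists (map_mx (real_complex R) x).
  by rewrite map_mx_eq0.
by rewrite -map_mxM Ax map_mxZ.
Qed.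

Lemma normc_ReE (R : rcfType) (z : R[i]) : `|z| = (complex.Re `|z|)%:C.
Proof. by rewrite normc_def. Qed.

Lemma spectrum_norm_le (R : realType) (n : nat) (A : 'M[R]_n.+1) (s : R) z :
  A \is a mxOver Num.nneg ->
  (forall w, s < w -> exists x, strict_supersolution A w x) ->
  spectrum A z -> complex.Re `|z| <= s.
Proof.
move=> A_ge0 s_lim /spectrumP[x x0 Axz]; rewrite leNgt; apply/negP.
move=> /s_lim[v zv]; pose y : 'cV[R]_n.+1 := \col_i complex.Re `|x i 0|.
have y0 i : 0 <= y i 0 by rewrite mxE normc_def sqrtr_ge0.
(* The triangle inequality gives [|z| y <= A y], so comparison at [|z|] applies to [- y]; as
   [y >= 0] too, the eigenvector vanishes. *)
have : forall i, 0 <= (- y) i 0.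
  apply: (supersolution_ge0 A_ge0 zv) => i.
  rewrite mulmxN !mxE mulrN lerN2 -lecR rmorphM /= -!normc_ReE -normrM.
  have -> : z * x i 0 = \sum_j (A i j)%:C * x j 0.
    move/colP/(_ i): Axz; rewrite !mxE => <-; apply: eq_bigr => j _.
    by rewrite mxE.
  rewrite (le_trans (ler_norm_sum _ _ _)) // rmorph_sum ler_sum // => j _.
  rewrite mxE rmorphM /= -normc_ReE normrM ler_wpM2r // ger0_norm //.
  by rewrite lecR; move/mxOverP: A_ge0 => /(_ i j); rewrite nnegrE.
move=> Ny0; case/negP: x0; apply/eqP/colP => i; rewrite mxE; apply/eqP.
rewrite -normr_eq0 normc_ReE; suff -> : complex.Re `|x i 0| = 0 by [].
have := Ny0 i; have := y0 i; rewrite !mxE oppr_ge0 => yi0 yi0'.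
by apply/le_anti; rewrite yi0 yi0'.
Qed.

Lemma perron_frobenius_eigenvalue (R : realType) (n : nat) (A : 'M[R]_n.+1) :
  A \is a mxOver Num.nneg ->
  let r := spectral_radius A in
  root (mxminpoly A) r /\
  forall w, r < w -> exists x, strict_supersolution A w x.
Proof.
move=> A_ge0 r; have [s [s_lim Ns]] := supersolution_threshold A_ge0.
have s_root := mxminpoly_root_threshold A_ge0 s_lim Ns.
have [x x0 Ax] := mxminpoly_root_eigvec s_root.
have s_spec := real_spectrum x0 Ax.
suff -> : r = s by [].
(* Needed for [s] to be its own modulus; a negative [s] would make 0 admissible, but admissible
   numbers are positive. *)
have s_ge0 : 0 <= s.
  rewrite leNgt; apply/negP => /s_lim[v /(strict_supersolution_gt0 A_ge0)].
  by rewrite ltxx.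
have s_mem : [set complex.Re `|z| | z in spectrum A]%classic s.
  by exists s%:C => //; rewrite ger0_norm // lecR.
have s_ub : ubound [set complex.Re `|z| | z in spectrum A]%classic s.
  by move=> _ [z /(spectrum_norm_le A_ge0 s_lim) ? <-].
apply/le_anti/andP; split; first by apply: ge_sup => //; exists s.
by apply: ub_le_sup => //; exists s.
Qed.

(** * Spans, images and nonnegative bases *)

Lemma set_span_submod (R : realType) (m : nat) (S : set 'cV[R]_m)
    (U : {vspace 'cV[R]_m}) (x : 'cV[R]_m) :
  (forall v, S v -> v \in U) -> set_span S x -> x \in U.
Proof.
move=> SU [s [sS]]; apply: subvP x; apply/span_subvP => v /sS.
exact: SU.
Qed.

(** Dominant eigenvectors are nonzero, while the image of a matrix contains 0; the empty sequence
    accounts for that vector. *)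
Lemma set_span_mem (R : realType) (m : nat) (S : set 'cV[R]_m) (x : 'cV[R]_m) :
  (x != 0 -> S x) -> set_span S x.
Proof.
have [-> _|x0 /(_ isT) Sx] := eqVneq x 0.
  by exists [::]; rewrite mem0v.
exists [:: x]; split; last by rewrite memv_span ?mem_head.
by move=> v; rewrite inE => /eqP ->.
Qed.

Lemma mem_limg_mulmx (F : fieldType) (m n : nat) (D : 'M[F]_(m, n))
    (x : 'cV[F]_m) :
  x \in limg (linfun (mulmx D : 'cV_n -> 'cV_m)) <-> exists y, x = D *m y.
Proof.
split=> [/memv_imgP[y _ ->]|[y ->]]; first by exists y; rewrite lfunE.
by apply/memv_imgP; exists y; rewrite ?memvf ?lfunE.
Qed.

Lemma span_colP (F : fieldType) (m n : nat) (D : 'M[F]_(m, n)) (x : 'cV[F]_m) :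
  x \in <<[seq col j D | j : 'I_n]>>%VS <-> exists y, x = D *m y.
Proof.
split=> [x_span|[y ->]].
  apply/mem_limg_mulmx; apply: subvP x x_span.
  apply/span_subvP => _ /mapP[j _ ->]; apply/mem_limg_mulmx.
  by exists (delta_mx j 0); rewrite colE.
have -> : D *m y = \sum_j y j 0 *: col j D.
  apply/colP => i; rewrite mxE summxE; apply: eq_bigr => j _.
  by rewrite !mxE mulrC.
apply: memv_suml => j _; apply/memvZ/memv_span/map_f.
by rewrite mem_enum.
Qed.

(** The columns of [D] are nonnegative and span [W]; a free subfamily of them is the basis. *)
Lemma nonneg_eigenbasis_of_image (R : realType) (m : nat) (A D : 'M[R]_m)
    (mu : R) (W : set 'cV[R]_m) :
  D \is a mxOver Num.nneg -> (forall y, eigspace A mu (D *m y)) ->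
  (forall x, W x <-> exists y, x = D *m y) -> has_nonneg_eigenbasis A mu W.
Proof.
move=> D_ge0 D_eig WD.
have [b [b_free b_cols b_span]] := free_subseq_span [seq col j D | j : 'I_m].
exists b; split; first split=> //.
  by apply/predeqP => x; rewrite WD -span_colP /= b_span.
move=> v vb; have /mapP[j _ vE] := b_cols v vb; split.
- exact: free_not0 b_free vb.
- by rewrite vE colE; apply: D_eig.
- by apply/mxOverP => i k; rewrite vE mxE; exact: (mxOverP D_ge0).
Qed.

Unset Implicit Arguments.

Theorem theorem3p6 (R : realType) (m : nat) (A : 'M[R]_m) (m_gt0 : (0 < m)%N)
    (A_ge0 : A \is a mxOver Num.nneg) :
  let r := spectral_radius A in
  [/\ spectrum A r%:C,
      has_nonneg_eigenbasis A r (dominant_eigspace A r)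
    & semisimple A r -> has_nonneg_eigenbasis A r (eigspace A r)].
Proof.
case: m A m_gt0 A_ge0 => // n A _ A_ge0 r.
have [r_root r_lim] := perron_frobenius_eigenvalue A_ge0.
rewrite -/r in r_root r_lim.
have [[|nu] [q]] := multiplicity_XsubC (mxminpoly A) r.
all: rewrite (monic_neq0 (mxminpoly_monic A)) /= => q_r pE.
  (* Multiplicity zero is impossible because [r] is a root; from here on the multiplicity is
     [nu.+1]. *)
  by move: q_r r_root; rewrite pE mulr1 => /negP.
pose D := horner_mx A (q * ('X - r%:P) ^+ nu).
have D_ge0 : D \is a mxOver Num.nneg.
  apply/mxOverP => i j; rewrite nnegrE.
  (* As the minimal polynomial vanishes at [r], its difference quotient there is the polynomial
     defining [D]. *)
  apply: (mxminpoly_quotient_ge0 A_ge0 r_lim).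
  by rewrite (rootP r_root) subr0 pE exprSr mulrA.
have D_eig y : eigspace A r (D *m y) := dominant_mx_ker pE y.
have [x Nx0 Nx1] : exists2 x : 'cV[R]_n.+1,
    (A - r%:M) ^+ nu *m x != 0 & (A - r%:M) ^+ nu.+1 *m x = 0.
  have /matrix0Pn[i [j Dij]] := dominant_mx_neq0 pE.
  (* Applying [(A - r%:M) ^+ nu] to this vector gives the nonzero column [j] of [D], so its order is
     exactly [nu.+1]. *)
  exists (horner_mx A q *m delta_mx j 0).
    rewrite mulmxA -dominant_mxE -colE.
    by apply/matrix0Pn; exists i, 0; rewrite mxE.
  by rewrite exprS -mulmxA [_ ^+ nu *m _]mulmxA -dominant_mxE; exact: D_eig.
have gen_nu y : gen_eigspace A r y -> (A - r%:M) ^+ nu.+1 *m y = 0.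
  by move=> [k _ Nky]; exact: (gen_ker_stable pE q_r Nky).
have ordE := cyclic_order_eq gen_nu Nx0 Nx1.
split.
- have [y y0 Ay] := mxminpoly_root_eigvec r_root.
  exact: real_spectrum y0 Ay.
- apply: (nonneg_eigenbasis_of_image D_ge0 D_eig) => z; split=> [z_dom|[y ->]].
    apply/mem_limg_mulmx; apply: set_span_submod z_dom => w [_ _ [y]].
    move=> [k _ Nky] ->; rewrite ordE; apply/mem_limg_mulmx.
    exact: (dominant_mx_image nu q_r Nky).
  apply: set_span_mem => Dy0; split=> //.
  exists (horner_mx A q *m y); last by rewrite ordE mulmxA -dominant_mxE.
  exists nu.+1 => //.
  by rewrite exprS -mulmxA [_ ^+ nu *m _]mulmxA -dominant_mxE; exact: D_eig.
(* Semisimplicity turns [x], of order [nu.+1], into an eigenvector. Hence [nu] is 0 and the image of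
   [D] is the whole eigenspace. *)
- move=> ss; have nu0 : nu = 0%N.
    have Nx : (A - r%:M) *m x = 0.
      by rewrite -[_ = 0]/(eigspace A r x) -ss; exists nu.+1.
    apply/eqP; rewrite -leqn0 leqNgt; apply: contra Nx0 => nu_gt0.
    by apply/eqP/(mulmx_exp_eq0 nu_gt0); rewrite expr1.
  apply: (nonneg_eigenbasis_of_image D_ge0 D_eig) => z; split=> [Nz|[y ->]//].
  have [y] : exists y, (A - r%:M) ^+ nu *m z = D *m y.
    by apply: (dominant_mx_image nu q_r (k := 1)); rewrite expr1.
  by rewrite nu0 expr0 mul1mx => ->; exists y.
Qed.
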